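(* Let $z_i,z_j\in\mathbb{C}\setminus\{0\}$ and $t_i,t_j\in\mathbb{C}$. Put $R=R_{\Gamma\Gamma}(i,j)$, $S=\Gamma(i)$, $T=\Gamma(j)$. Then for every choice of spins $\sigma,\tau,\alpha,\beta,\rho,\theta\in\{+,-\}$, $$\sum_{\gamma,\mu,\nu\in\{\pm\}}R_{\sigma\tau}^{\nu\mu}S_{\nu\beta}^{\theta\gamma}T_{\mu\gamma}^{\rho\alpha}=\sum_{\delta,\phi,\psi\in\{\pm\}}T_{\tau\beta}^{\psi\delta}S_{\sigma\delta}^{\phi\alpha}R_{\phi\psi}^{\theta\rho}.$$
   Context: Let $V$ be a two-dimensional vector space with basis $v_+,v_-$. For $R\in\operatorname{End}(V\otimes V)$ define coefficients $R_{\nu\beta}^{\theta\gamma}$ ($\nu,\beta,\theta,\gamma\in\{+,-\}$) by $R(v_\nu\otimes v_\beta)=\sum_{\theta,\gamma}R_{\nu\beta}^{\theta\gamma}v_\theta\otimes v_\gamma$; equivalently, $R$ is given by a $4\times4$ matrix (acting on column vectors) in the ordered basis $v_+\otimes v_+,\ v_+\otimes v_-,\ v_-\otimes v_+,\ v_-\otimes v_-$. Define $$\Gamma(i)=\begin{pmatrix}1&0&0&0\\0&t_i&z_i(t_i+1)&0\\0&1&z_i&0\\0&0&0&z_i\end{pmatrix},$$ and $$R_{\Gamma\Gamma}(i,j)=\begin{pmatrix}z_j+t_jz_i&0&0&0\\0&t_iz_j-t_jz_i&z_i(t_i+1)&0\\0&z_j(t_j+1)&z_i-z_j&0\\0&0&0&z_i+t_iz_j\end{pmatrix}.$$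 *)

(* Defs.v *)
From HB Require Import structures.
From mathcomp Require Import all_boot all_order all_algebra.
From mathcomp Require Import reals.
From mathcomp.real_closed Require Import complex.

Set Implicit Arguments.
Unset Strict Implicit.
Unset Printing Implicit Defensive.

Import GRing.Theory.
Local Open Scope ring_scope.

(* true encodes +, false encodes -. *)
Definition spin : Type := bool.
HB.instance Definition _ := Finite.on spin.

(* Position of v_a (x) v_b in the ordered basis
   v_+ (x) v_+, v_+ (x) v_-, v_- (x) v_+, v_- (x) v_- of V (x) V. *)
Definition tensor_index (a b : spin) : 'I_4 :=
  match a, b with
  | true, true => @Ordinal 4 0 isT
  | true, false => @Ordinal 4 1 isT
  | false, true => @Ordinal 4 2 isT
  | false, false => @Ordinal 4 3 isT
  end.

Section Coefficients.
Variable K : fieldType.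

Definition tensor_basis (a b : spin) : 'cV[K]_4 :=
  delta_mx (tensor_index a b) 0.

(* [coef M nu beta theta gamma] is M_{nu beta}^{theta gamma}. Matrices act on
   column vectors, so the input pair (nu, beta) selects the column; see
   [coefP]. *)
Definition coef (M : 'M[K]_4) (nu beta theta gamma : spin) : K :=
  M (tensor_index theta gamma) (tensor_index nu beta).

Lemma coefP (M : 'M[K]_4) (nu beta : spin) :
  M *m tensor_basis nu beta =
  \sum_(theta : spin) \sum_(gamma : spin)
    coef M nu beta theta gamma *: tensor_basis theta gamma.
Proof.
rewrite /tensor_basis -colE; apply/colP => k.
rewrite !(big_bool, mxE) /coef /=.
case: k => -[|[|[|[|//]]]] lt_k; rewrite /= ?mulr1 ?mulr0 ?add0r ?addr0;
  by congr (M _ _); apply: val_inj.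
Qed.

Definition mx4 (rows : seq (seq K)) : 'M[K]_4 :=
  \matrix_(i < 4, j < 4) nth 0 (nth [::] rows i) j.

Definition Gamma (z t : K) : 'M[K]_4 :=
  mx4 [:: [:: 1; 0; 0; 0];
          [:: 0; t; z * (t + 1); 0];
          [:: 0; 1; z; 0];
          [:: 0; 0; 0; z]].

Definition R_GammaGamma (zi ti zj tj : K) : 'M[K]_4 :=
  mx4 [:: [:: zj + tj * zi; 0; 0; 0];
          [:: 0; ti * zj - tj * zi; zi * (ti + 1); 0];
          [:: 0; zj * (tj + 1); zi - zj; 0];
          [:: 0; 0; 0; zi + ti * zj]].

End Coefficients.

(* Main.v *)
Require Import Defs.
From mathcomp Require Import all_boot all_order all_algebra.
From mathcomp Require Import reals.
From mathcomp.real_closed Require Import complex.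
From mathcomp Require Import ring.

Local Open Scope ring_scope.
Local Open Scope complex_scope.

(** For fixed boundary spins the equation is a polynomial identity in [zi], [zj], [ti], [tj], so
    finitely many expansions decide it over any field. All three matrices obey the ice rule (an
    entry vanishes unless input and output contain equally many minus spins). Hence both sides are 0
    unless ([sigma], [tau], [beta]) and ([theta], [rho], [alpha]) do too, which leaves 20 of the 64
    cases. A typical one, from inputs + + - to outputs - + +, is [zj + tj * zi = tj * (zi - zj) + zj
    * (tj + 1)]. *)

Lemma yang_baxter_Gamma (K : fieldType) (zi zj ti tj : K)
    (sigma tau alpha beta rho theta : spin) :
  let R := R_GammaGamma zi ti zj tj in
  let S := Gamma zi ti in
  let T := Gamma zj tj in
  \sum_(gamma : spin) \sum_(mu : spin) \sum_(nu : spin)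
    coef R sigma tau nu mu * coef S nu beta theta gamma
      * coef T mu gamma rho alpha
  = \sum_(delta : spin) \sum_(phi : spin) \sum_(psi : spin)
    coef T tau beta psi delta * coef S sigma delta phi alpha
      * coef R phi psi theta rho.
Proof.
move=> R S T; rewrite !big_bool /R /S /T /coef /Gamma /R_GammaGamma /mx4 !mxE.
(* The [nth] lookups compute only once every boundary spin is a constructor; [/=] then leaves
   explicit polynomials for [ring]. *)
by case: sigma; case: tau; case: alpha; case: beta; case: rho; case: theta;
  rewrite /=; ring.
Qed.

Theorem theorem4 (F : realType) (zi zj ti tj : F[i])
    (zi_neq0 : zi != 0) (zj_neq0 : zj != 0) :
  let R := R_GammaGamma zi ti zj tj in
  let S := Gamma zi ti in
  let T := Gamma zj tj in
  forall sigma tau alpha beta rho theta : spin,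
    \sum_(gamma : spin) \sum_(mu : spin) \sum_(nu : spin)
      coef R sigma tau nu mu * coef S nu beta theta gamma
        * coef T mu gamma rho alpha
    = \sum_(delta : spin) \sum_(phi : spin) \sum_(psi : spin)
      coef T tau beta psi delta * coef S sigma delta phi alpha
        * coef R phi psi theta rho.
Proof. by move=> R S T *; apply: yang_baxter_Gamma. Qed.
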